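(* Fix constants $\gamma_2\ge\gamma_1\ge1$. There exist constants $K,C>0$ (depending only on $\gamma_1,\gamma_2$) and a first-order method with the following property. Consider any problem $\min_xF(x)=g(x)+h(c(x))$ as described in the context, a real $\|\nabla c\|$ with $\sup_{x\in\operatorname{dom} g}\|\nabla c(x)\|_{\rm op}\le\|\nabla c\|<\infty$, a point $x_0\in\operatorname{dom} g$, and a target accuracy $\varepsilon>0$, and suppose that $\inf F>-\infty$ and that each of the quantities $\|\nabla c\|$, $L$, $\beta$, $F(x_0)-\inf F$, $1/\varepsilon$ is at least $K$. Suppose moreover that a real $q>0$ is known with $$\frac{q}{F(x_0)-\inf F}\in[\gamma_1,\gamma_2].$$ Then the method, started at $x_0$ and given $q$, generates a point $x$ satisfying $\|\mathcal{G}_{1/\mu}(x)\|\le\varepsilon$, where $\mu=L\beta$, after at most $$C\cdot\frac{L^2\beta\|\nabla c\|\cdot\big(F(x_0)-\inf F\big)}{\varepsilon^3}$$ basic operations.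
   Context: Setting: $g\colon\mathbf{R}^d\to\mathbf{R}\cup\{+\infty\}$ is proper, closed and convex; $h\colon\mathbf{R}^m\to\mathbf{R}$ is convex and $L$-Lipschitz continuous; $c\colon\mathbf{R}^d\to\mathbf{R}^m$ is $C^1$-smooth with $\|\nabla c(x)-\nabla c(y)\|_{\rm op}\le\beta\|x-y\|$ for all $x,y$. Set $\mu:=L\beta$ and $F(x):=g(x)+h(c(x))$. For $t>0$ define $F_t(z;y):=g(z)+h\big(c(y)+\nabla c(y)(z-y)\big)+\frac{1}{2t}\|z-y\|^2$, $S_t(y):=\operatorname{argmin}_z F_t(z;y)$, and the prox-gradient $\mathcal{G}_t(x):=t^{-1}(x-S_t(x))$. Proximal maps: $\operatorname{prox}_{tf}(x):=\operatorname{argmin}_z\{f(z)+\frac{1}{2t}\|z-x\|^2\}$. A basic operation is an evaluation of $c(x)$, a matrix-vector product $\nabla c(x)v$ or $\nabla c(x)^*w$, or an evaluation of $\operatorname{prox}_{th}$ or $\operatorname{prox}_{tg}$. The method has access to the problem only through basic operations (and ordinary vector arithmetic), together with the values $L$, $\beta$, $\|\nabla c\|$, $\varepsilon$, $q$. *)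

(* Defs.v *)
(* MathComp-Analysis. *)
From HB Require Import structures.
From mathcomp Require Import all_boot all_order all_algebra.
From mathcomp Require Import all_classical all_reals all_analysis.

Set Implicit Arguments.
Unset Strict Implicit.
Unset Printing Implicit Defensive.

Import Order.TTheory GRing.Theory Num.Theory.
Import numFieldNormedType.Exports.

Local Open Scope classical_set_scope.
Local Open Scope ring_scope.

(* Vectors are row vectors and the Jacobian [jacobian c x : 'M_(d, m)] acts on
   the right: the derivative applied to v is [v *m jacobian c x], its adjoint
   applied to w is [w *m (jacobian c x)^T].  The canonical norm of 'rV[R]_n is
   the sup norm, so Euclidean quantities are introduced separately; the topology
   and differentiability are the same for both norms. *)

Definition dot (R : realType) (n : nat) (x y : 'rV[R]_n) : R :=
  \sum_(i < n) x ord0 i * y ord0 i.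

Definition enorm (R : realType) (n : nat) (x : 'rV[R]_n) : R :=
  Num.sqrt (dot x x).

Definition opnorm (R : realType) (d m : nat) (A : 'M[R]_(d, m)) : R :=
  sup [set enorm (v *m A) | v in [set v : 'rV[R]_d | enorm v <= 1]].

Definition edom (R : realType) (n : nat) (f : 'rV[R]_n -> \bar R) :
  set 'rV[R]_n := [set x | (f x < +oo)%E].

Definition proper_fun (R : realType) (n : nat) (f : 'rV[R]_n -> \bar R) : Prop :=
  (forall x, f x != -oo%E) /\ edom f !=set0.

Definition epigraph (R : realType) (n : nat) (f : 'rV[R]_n -> \bar R) :
  set ('rV[R]_n * R) := [set p | (f p.1 <= p.2%:E)%E].

Definition closed_fun (R : realType) (n : nat) (f : 'rV[R]_n -> \bar R) : Prop :=
  closed (epigraph f).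

(* Uses the convention 0 * +oo = 0 of \bar R at the end points s = 0, 1. *)
Definition convex_efun (R : realType) (n : nat) (f : 'rV[R]_n -> \bar R) : Prop :=
  forall (x y : 'rV[R]_n) (s : R), 0 <= s <= 1 ->
    (f (s *: x + (1 - s) *: y)%R <= s%:E * f x + (1 - s)%:E * f y)%E.

Definition argmin_set (R : realType) (n : nat) (f : 'rV[R]_n -> \bar R) :
  set 'rV[R]_n := [set z | forall w, (f z <= f w)%E].

(* The minimizer of f; it is only meaningful when argmin_set f is a singleton,
   as for proper closed strongly convex f. *)
Definition argmin (R : realType) (n : nat) (f : 'rV[R]_n -> \bar R) : 'rV[R]_n :=
  xget 0 (argmin_set f).

Definition prox (R : realType) (n : nat) (t : R) (f : 'rV[R]_n -> \bar R)
    (x : 'rV[R]_n) : 'rV[R]_n :=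
  argmin (fun z => f z + ((2 * t)^-1 * enorm (z - x) ^+ 2)%:E)%E.

Section CompositeProblem.
Variables (R : realType) (d m : nat).
Variables (g : 'rV[R]_d -> \bar R) (h : 'rV[R]_m -> R) (c : 'rV[R]_d -> 'rV[R]_m).

Definition objective (x : 'rV[R]_d) : \bar R := (g x + (h (c x))%:E)%E.

Definition prox_linear_model (t : R) (y z : 'rV[R]_d) : \bar R :=
  (g z + (h (c y + (z - y) *m jacobian c y)
          + (2 * t)^-1 * enorm (z - y) ^+ 2)%:E)%E.

Definition prox_linear_step (t : R) (y : 'rV[R]_d) : 'rV[R]_d :=
  argmin (prox_linear_model t y).

Definition prox_gradient (t : R) (x : 'rV[R]_d) : 'rV[R]_d :=
  t^-1 *: (x - prox_linear_step t x).

(* F(x) - inf F; a genuine difference of reals when x is in dom g and inf F is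
   finite. *)
Definition initial_gap (x : 'rV[R]_d) : R :=
  fine (objective x - ereal_inf (range objective))%E.

Record composite_problem (L beta : R) : Prop := CompositeProblem {
  reg_proper : proper_fun g;
  reg_closed : closed_fun g;
  reg_convex : convex_efun g;
  outer_convex : convex_function setT h;
  outer_lipschitz : forall u v, `|h u - h v| <= L * enorm (u - v);
  inner_differentiable : forall x, differentiable c x;
  inner_C1 : continuous (jacobian c);
  inner_smooth :
    forall x y, opnorm (jacobian c x - jacobian c y) <= beta * enorm (x - y)
}.

End CompositeProblem.

(* First-order programs: register machines with a bank X of vectors of R^d and
   a bank Y of vectors of R^m.  In each instruction the first register index is
   the destination.  A program never sees the coordinates of a vector, nor the
   functions g, h, c: vectors are only combined linearly, paired by inner
   products, or passed to a basic operation.  The scalars returned by inner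
   products can be processed and tested freely by the continuation.  Programs
   do not depend on d and m. *)
Inductive program (R : realType) : Type :=
| Return (i : nat)
| CombX (k : nat) (a : R) (i : nat) (b : R) (j : nat) (p : program R)
| CombY (k : nat) (a : R) (i : nat) (b : R) (j : nat) (p : program R)
| DotX (i j : nat) (p : R -> program R)
| DotY (i j : nat) (p : R -> program R)
| EvalC (k i : nat) (p : program R)
| MulJac (k i j : nat) (p : program R)
| MulJacT (k i j : nat) (p : program R)
| ProxG (t : {posnum R}) (k i : nat) (p : program R)
| ProxH (t : {posnum R}) (k i : nat) (p : program R).

Arguments Return {R} i.

Section Semantics.
Variables (R : realType) (d m : nat).
Variables (g : 'rV[R]_d -> \bar R) (h : 'rV[R]_m -> R) (c : 'rV[R]_d -> 'rV[R]_m).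

(* The point returned by a program, and the number of basic operations used. *)
Fixpoint run (p : program R) (X : nat -> 'rV[R]_d) (Y : nat -> 'rV[R]_m) :
    'rV[R]_d * nat :=
  let tick (r : 'rV[R]_d * nat) := (r.1, r.2.+1) in
  match p with
  | Return i => (X i, 0%N)
  | CombX k a i b j p' => run p' [eta X with k |-> a *: X i + b *: X j] Y
  | CombY k a i b j p' => run p' X [eta Y with k |-> a *: Y i + b *: Y j]
  | DotX i j p' => run (p' (dot (X i) (X j))) X Y
  | DotY i j p' => run (p' (dot (Y i) (Y j))) X Y
  | EvalC k i p' => tick (run p' X [eta Y with k |-> c (X i)])
  | MulJac k i j p' =>
      tick (run p' X [eta Y with k |-> X j *m jacobian c (X i)])
  | MulJacT k i j p' =>
      tick (run p' [eta X with k |-> Y j *m (jacobian c (X i))^T] Y)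
  | ProxG t k i p' => tick (run p' [eta X with k |-> prox t%:num g (X i)] Y)
  | ProxH t k i p' =>
      tick (run p' X [eta Y with k |-> prox t%:num (fun u => (h u)%:E) (Y i)])
  end.

Definition run_from (p : program R) (x0 : 'rV[R]_d) : 'rV[R]_d * nat :=
  run p (fun i => if i == 0%N then x0 else 0) (fun=> 0).

End Semantics.

(* A method selects its program from the known values
   L, beta, ||nabla c||, epsilon, q, in this order. *)
Definition first_order_method (R : realType) : Type :=
  R -> R -> R -> R -> R -> program R.

(* Main.v *)
Require Import Defs.
From HB Require Import structures.
From mathcomp Require Import all_boot all_order all_algebra.
From mathcomp Require Import all_classical all_reals all_analysis.
From mathcomp Require Import ring lra.

Import Order.TTheory GRing.Theory Num.Theory.
Import numFieldNormedType.Exports.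

Local Open Scope classical_set_scope.
Local Open Scope ring_scope.

Set Implicit Arguments.
Unset Strict Implicit.
Unset Printing Implicit Defensive.

(** The method is an inexact prox-linear method.  Write mu = L * beta and
    S = S_{1/mu}(y).

    Outer level.  Since the linearization error of c is at most
    beta/2 |z - y|^2, the prox-linear model F_{1/mu}(.; y) majorizes F
    ([model_majorizes]); it touches F at y and is strongly convex with modulus
    mu, so minimizing it decreases F by mu/2 |S - y|^2.  This survives an
    inexact minimization with model error at most
    mu/16 |S - y|^2 + eps^2 / (64 mu): the computed point x is then so close to
    S that |x - y| decides between two cases.  If |x - y| <= eps / (2 mu), then
    |S - y| <= eps / mu and y is the desired point ([stop_test_sound]);
    otherwise F(x) <= F(y) - eps^2 / (48 mu) ([no_stop_descent]).  The test only
    involves an inner product, so function values are never needed.  The second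
    case happens fewer than 48 mu (F(x0) - inf F) / eps^2 + 1 times, and q, an
    upper bound of the gap within a constant factor, tells how many rounds the
    program has to provide ([run_prox_linear_program]).

    Inner level.  An error relative to |S - y|^2, rather than to the initial
    model gap, is what keeps a logarithm out of the complexity.  The outer
    function h is replaced by its Moreau envelope with parameter
    nu = eps^2 / (32 mu L^2), at the price of an error
    nu L^2 / 2 = eps^2 / (64 mu) ([le_moreau_env]); the smooth part of the model
    then has curvature M = |nabla c|^2 / nu + mu, and k steps of the accelerated
    proximal gradient method started at y leave an error
    2 M |S - y|^2 / (k (k + 1)) ([apg_rate]), whatever the model value at y is.
    This is at most mu/16 |S - y|^2 for k of the order of
    sqrt (M / mu), that is, of L |nabla c| / eps.  Each step uses four basic
    operations, so the total is of the order of
    (mu (F(x0) - inf F) / eps^2) * (L |nabla c| / eps).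

    Both levels rest on the variational inequality of a proximal point
    ([prox_spec]), which is applied to g, to h, and to the sum of g and the
    linearized h, whose proximal point at y is S. *)

(** * Euclidean geometry and operator norms *)

Section Euclidean.
Variables (R : realType).

Section InnerProduct.
Variable n : nat.
Implicit Types (x y z : 'rV[R]_n) (a b : R).

Lemma dotC x y : dot x y = dot y x.
Proof. by apply: eq_bigr => i _; rewrite mulrC. Qed.

Lemma dotDl x y z : dot (x + y) z = dot x z + dot y z.
Proof. by rewrite -big_split; apply: eq_bigr => i _; rewrite mxE mulrDl. Qed.

Lemma dotZl a x y : dot (a *: x) y = a * dot x y.
Proof. by rewrite mulr_sumr; apply: eq_bigr => i _; rewrite mxE mulrA. Qed.

Lemma dotNl x y : dot (- x) y = - dot x y.
Proof. by rewrite -scaleN1r dotZl mulN1r. Qed.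

Lemma dotDr x y z : dot z (x + y) = dot z x + dot z y.
Proof. by rewrite dotC dotDl !(dotC z). Qed.

Lemma dotZr a x y : dot y (a *: x) = a * dot y x.
Proof. by rewrite dotC dotZl (dotC y). Qed.

Lemma dotNr x y : dot y (- x) = - dot y x.
Proof. by rewrite dotC dotNl (dotC y). Qed.

Definition dotE := (dotDl, dotDr, dotNl, dotNr, dotZl, dotZr).

Lemma dot0l x : dot 0 x = 0.
Proof. by rewrite -(scale0r 0) dotZl mul0r. Qed.

Lemma dot_ge0 x : 0 <= dot x x.
Proof. by apply: sumr_ge0 => i _; rewrite -expr2 sqr_ge0. Qed.

Lemma dot_eq0 x : (dot x x == 0) = (x == 0).
Proof.
apply/eqP/eqP => [|->]; last exact: dot0l.
move/eqP; rewrite psumr_eq0 => [/allP x0|i _]; last by rewrite -expr2 sqr_ge0.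
apply/rowP => i; rewrite mxE; apply/eqP.
by have := x0 i (mem_index_enum _); rewrite /= -expr2 sqrf_eq0.
Qed.

Lemma enorm_ge0 x : 0 <= enorm x.
Proof. exact: sqrtr_ge0. Qed.

Lemma enorm_sqr x : enorm x ^+ 2 = dot x x.
Proof. by rewrite sqr_sqrtr // dot_ge0. Qed.

Lemma enorm_le x b : 0 <= b -> (enorm x <= b) = (dot x x <= b ^+ 2).
Proof. by move=> b0; rewrite -enorm_sqr ler_pXn2r ?nnegrE ?enorm_ge0. Qed.

Lemma enormZ a x : enorm (a *: x) = `|a| * enorm x.
Proof. by rewrite /enorm !dotE mulrA -expr2 sqrtrM ?sqr_ge0 // sqrtr_sqr. Qed.

Lemma enormN x : enorm (- x) = enorm x.
Proof. by rewrite /enorm !dotE opprK. Qed.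

Lemma cauchy_schwarz x y : dot x y <= enorm x * enorm y.
Proof.
have [->|x0] := eqVneq x 0.
  by rewrite dot0l mulr_ge0 ?enorm_ge0.
have xp : 0 < dot x x by rewrite lt_neqAle eq_sym dot_eq0 x0 dot_ge0.
apply: (le_trans (ler_norm _)).
rewrite -ler_sqr ?nnegrE ?mulr_ge0 ?enorm_ge0 //.
rewrite exprMn !enorm_sqr real_normK ?num_real //.
have := dot_ge0 (dot x x *: y - dot x y *: x); rewrite !dotE (dotC y x).
set A := dot x x; set B := dot x y; set D := dot y y => h.
have {h} : 0 <= A * (A * D - B ^+ 2) by nra.
by rewrite pmulr_rge0 // subr_ge0.
Qed.

Lemma enormD x y : enorm (x + y) <= enorm x + enorm y.
Proof.
rewrite enorm_le ?addr_ge0 ?enorm_ge0 // !dotE (dotC y x).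
have := cauchy_schwarz x y; rewrite sqrrD !enorm_sqr; lra.
Qed.

Lemma sup_norm_le x : `|x| <= enorm x.
Proof.
have h i : `|x ord0 i| <= enorm x.
  rewrite -sqrtr_sqr ler_wsqrtr // /dot (bigD1 i) //= -expr2 lerDl.
  by apply: sumr_ge0 => j _; rewrite -expr2 sqr_ge0.
rewrite /Num.Def.normr/= mx_normrE.
by apply: bigmax_le; [exact: enorm_ge0|move=> [i j] _; rewrite ord1 /=].
Qed.

(** This identity is the source of every strong convexity estimate below. *)
Lemma enorm_conv x y (s : R) :
  dot (s *: x + (1 - s) *: y) (s *: x + (1 - s) *: y) =
  s * dot x x + (1 - s) * dot y y - s * (1 - s) * dot (x - y) (x - y).
Proof. by rewrite !dotE (dotC y x); ring. Qed.

End InnerProduct.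

Section OperatorNorm.
Variables d m : nat.
Implicit Types A : 'M[R]_(d, m).

Lemma dot_adjoint A (x : 'rV[R]_d) (w : 'rV[R]_m) :
  dot (w *m A^T) x = dot w (x *m A).
Proof.
rewrite /dot.
under eq_bigr do rewrite mxE big_distrl /=.
rewrite exchange_big /=; apply: eq_bigr => j _.
rewrite mxE big_distrr /=; apply: eq_bigr => i _.
by rewrite mxE; ring.
Qed.

Lemma enorm_mulmx_bounded A :
  exists2 B, 0 <= B & forall v, enorm (v *m A) <= B * enorm v.
Proof.
exists (Num.sqrt (\sum_j dot (row j A^T) (row j A^T))); first exact: sqrtr_ge0.
move=> v; rewrite enorm_le ?mulr_ge0 ?sqrtr_ge0 ?enorm_ge0 //.
rewrite exprMn sqr_sqrtr ?sumr_ge0// => [|j _]; last exact: dot_ge0.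
rewrite mulr_suml /dot; apply: ler_sum => j _.
have -> : (v *m A) ord0 j = dot v (row j A^T).
  by rewrite mxE; apply: eq_bigr => i _; rewrite !mxE.
rewrite -expr2 -[leLHS]real_normK ?num_real // -/(dot _ _) -enorm_sqr -exprMn.
rewrite ler_pXn2r ?nnegrE ?mulr_ge0 ?enorm_ge0 // ler_norml.
rewrite mulrC cauchy_schwarz andbT lerNl -dotNl.
by rewrite -(enormN v) cauchy_schwarz.
Qed.

(** [opnorm] is a supremum, which bounds its set only once that set is known to be
    nonempty and bounded; [enorm_mulmx_bounded] provides the bound. *)
Lemma enorm_mulmx A (v : 'rV[R]_d) : enorm (v *m A) <= opnorm A * enorm v.
Proof.
have [B B0 AB] := enorm_mulmx_bounded A.
have ub : has_sup [set enorm (u *m A) | u in [set u : 'rV[R]_d | enorm u <= 1]].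
  split.
    by exists (enorm (0 *m A)), 0 => //=; rewrite /enorm dot0l sqrtr0 ler01.
  exists B => _ [u /= u1 <-]; apply: (le_trans (AB u)).
  by rewrite -[leRHS]mulr1 ler_wpM2l.
have [v0|v0] := eqVneq (enorm v) 0.
  by have := AB v; rewrite v0 !mulr0.
have vp : 0 < enorm v by rewrite lt_neqAle eq_sym v0 enorm_ge0.
rewrite -ler_pdivrMr //; apply: sup_upper_bound => //.
exists ((enorm v)^-1 *: v) => /=.
  by rewrite enormZ gtr0_norm ?invr_gt0 // mulVf.
by rewrite -scalemxAl enormZ gtr0_norm ?invr_gt0 // mulrC.
Qed.

End OperatorNorm.
End Euclidean.

(** * The linearization error of a map with Lipschitz Jacobian *)

Section InnerProductContinuity.
Variables (R : realType) (n : nat).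

Lemma continuous_dotr (r : 'rV[R]_n) : continuous (dot r).
Proof.
move=> x; apply: (@cvg_big _ _ _ _ _ (@add_continuous _) _ (nbhs x)).
move=> i _; apply: cvgM; first exact: cvg_cst.
exact: coord_continuous.
Qed.

Lemma continuous_sqr_dist (x : 'rV[R]_n) :
  continuous (fun z : 'rV[R]_n => enorm (z - x) ^+ 2).
Proof.
move=> z; under eq_fun do rewrite enorm_sqr.
have cf i : (fun w : 'rV[R]_n => (w - x) ord0 i) @ z --> (z - x) ord0 i.
  under eq_fun do rewrite !mxE; rewrite !mxE.
  by apply: (@cvgB _ _ _ (nbhs z)); [exact: coord_continuous|exact: cvg_cst].
rewrite /dot; apply: (@cvg_big _ _ _ _ _ (@add_continuous _) _ (nbhs z)).
by move=> i _; apply: cvgM; exact: cf.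
Qed.

(** The topology is that of the sup norm, which the Euclidean norm dominates. *)
Lemma nbhs_enorm_ball (x : 'rV[R]_n) (V : set 'rV[R]_n) : nbhs x V ->
  exists2 r, 0 < r & forall w, enorm (w - x) < r -> V w.
Proof.
move=> /nbhs_normP[r /= r0 rV]; exists r => // w wr; apply: rV => /=.
by rewrite /ball_ /= distrC (le_lt_trans (sup_norm_le _)).
Qed.

End InnerProductContinuity.

Section Linearization.
Variables (R : realType) (d m : nat) (c : 'rV[R]_d -> 'rV[R]_m) (beta : R).
Hypothesis beta_ge0 : 0 <= beta.
Hypothesis c_diff : forall x, differentiable c x.
Hypothesis c_smooth :
  forall x y, opnorm (jacobian c x - jacobian c y) <= beta * enorm (x - y).

Lemma is_derive_dot_line (r : 'rV[R]_m) (y v : 'rV[R]_d) (t : R) :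
  is_derive t 1 (fun s => dot r (c (y + s *: v)))
    (dot r (v *m jacobian c (y + t *: v))).
Proof.
have [dc Dc] : is_derive (y + t *: v) v c (v *m jacobian c (y + t *: v)).
  by split; [exact: diff_derivable|rewrite deriveEjacobian].
have cv : (fun s => s^-1 *: (dot r (c (y + (s *: (1 : R) + t) *: v)) -
    dot r (c (y + t *: v)))) @ (0 : R)^' --> dot r (v *m jacobian c (y + t *: v)).
  rewrite -Dc.
  have -> : (fun s : R => s^-1 *: (dot r (c (y + (s *: (1 : R) + t) *: v)) -
      dot r (c (y + t *: v)))) = dot r \o
      (fun s => s^-1 *: (c (s *: v + (y + t *: v)) - c (y + t *: v))).
    apply/funext => s /=; rewrite !dotE.
    suff -> : y + (s *: (1 : R) + t) *: v = s *: v + (y + t *: v) by [].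
    by rewrite scalerDl addrCA [s *: (1 : R)]mulr1.
  apply: continuous_cvg; first exact: continuous_dotr.
  exact: dc.
split; first by apply/cvg_ex; eexists; exact: cv.
exact: cvg_lim cv.
Qed.

Lemma is_derive_sub_quadratic (phi : R -> R) (dphi p b s : R) :
  is_derive s 1 phi dphi ->
  is_derive s 1 (fun u => phi u - u * p - b * u ^+ 2) (dphi - p - 2 * b * s).
Proof.
move=> h; apply: is_derive_eq => /=.
by rewrite /GRing.scale /=; ring.
Qed.

(** Pair the residual r with c along the segment from y to z: after subtracting
    the linear term and |r| beta/2 |z - y|^2 s^2, the resulting scalar function G
    has a nonpositive derivative, so the mean value theorem gives G 1 <= G 0,
    that is, |r|^2 <= |r| beta/2 |z - y|^2. *)
Lemma linearization_error (y z : 'rV[R]_d) :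
  enorm (c z - (c y + (z - y) *m jacobian c y)) <= beta / 2 * enorm (z - y) ^+ 2.
Proof.
set v := z - y; set r := c z - _.
pose B := enorm r * (beta * enorm v ^+ 2).
pose G s : R := dot r (c (y + s *: v)) - s * dot r (v *m jacobian c y) -
  B / 2 * (s ^+ 2).
pose dG s : R := dot r (v *m jacobian c (y + s *: v)) -
  dot r (v *m jacobian c y) - B * s.
have dGE (s : R) : is_derive s 1 G (dG s).
  rewrite /dG (_ : B * s = 2 * (B / 2) * s); last by field.
  exact/is_derive_sub_quadratic/is_derive_dot_line.
have [t t01] : exists2 t, t \in `]0%R, 1%R[ & G 1 - G 0 = dG t * (1 - 0).
  apply: MVT => //; apply: continuous_subspaceT => s.
  by apply: differentiable_continuous; apply/derivable1_diffP; apply: ex_derive.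
rewrite subr0 mulr1 => GE.
have t0 : 0 <= t by move: t01; rewrite in_itv /= => /andP[/ltW].
have : dG t <= 0.
  rewrite /dG subr_le0 -dotNr -dotDr -mulmxBr.
  apply: (le_trans (cauchy_schwarz _ _)); rewrite /B -mulrA ler_wpM2l ?enorm_ge0 //.
  apply: (le_trans (enorm_mulmx _ _)).
  have : opnorm (jacobian c (y + t *: v) - jacobian c y) <= beta * (t * enorm v).
    apply: (le_trans (c_smooth _ _)).
    by rewrite [y + _]addrC addrK enormZ ger0_norm.
  move=> /(ler_wpM2r (enorm_ge0 v)) /le_trans; apply.
  by rewrite le_eqVlt; apply/orP; left; apply/eqP; ring.
rewrite -GE /G scale1r scale0r addr0 /v [y + _]addrC subrK -/v.
have -> : dot r (c z) = dot r r + dot r (c y) + dot r (v *m jacobian c y).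
  by rewrite -!dotDr -addrA subrK.
rewrite -enorm_sqr /B => h.
have {}h : enorm r * (enorm r - beta / 2 * enorm v ^+ 2) <= 0 by lra.
have [->|r0] := eqVneq (enorm r) 0.
  by rewrite mulr_ge0 ?divr_ge0 ?sqr_ge0.
rewrite -subr_le0 -(@pmulr_rle0 _ (enorm r)) //.
by rewrite lt_neqAle eq_sym r0 enorm_ge0.
Qed.

End Linearization.

(** * Proximal points of closed convex functions *)

Section ProximalPoint.
Variables (R : realType) (n : nat) (f : 'rV[R]_n -> \bar R).
Hypotheses (f_proper : proper_fun f) (f_lsc : lower_semicontinuous f)
  (f_convex : convex_efun f).

Lemma fin_num_edom x : edom f x -> f x \is a fin_num.
Proof. by move=> xf; rewrite fin_numE f_proper.1 lt_eqF. Qed.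

Lemma edom_conv x y (s : R) : 0 <= s <= 1 -> edom f x -> edom f y ->
  edom f (s *: x + (1 - s) *: y) /\
  fine (f (s *: x + (1 - s) *: y)) <= s * fine (f x) + (1 - s) * fine (f y).
Proof.
move=> s01 xf yf; have := f_convex x y s01.
rewrite -(fineK (fin_num_edom xf)) -(fineK (fin_num_edom yf)) -!EFinM -EFinD.
move=> h; have wf : edom f (s *: x + (1 - s) *: y).
  by rewrite /edom /= (le_lt_trans h) ?ltry.
by split => //; rewrite -lee_fin (fineK (fin_num_edom wf)).
Qed.

(** Lower semicontinuity bounds f from below by f x0 - 1 on a ball of radius r
    around x0.  For a farther point z, the point at distance r/2 from x0 towards z
    lies in that ball, and convexity transports the bound to z with a loss
    proportional to |z - x0|.  Together with a quadratic term this makes the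
    proximal objective bounded below. *)
Lemma affine_minorant x0 : edom f x0 -> exists2 B, 0 <= B &
  forall z, edom f z -> fine (f x0) - 1 - B * enorm (z - x0) <= fine (f z).
Proof.
move=> x0f.
have : ((fine (f x0) - 1)%:E < f x0)%E.
  by rewrite -[ltRHS]fineK ?fin_num_edom // lte_fin ltrBlDr ltrDl.
move=> /f_lsc[V /nbhs_enorm_ball[r r0 rV] fV].
have near_x0 z : edom f z -> enorm (z - x0) < r -> fine (f x0) - 1 < fine (f z).
  by move=> zf /rV/fV; rewrite -{1}[f z]fineK ?fin_num_edom // lte_fin.
exists (2 / r) => [|z zf]; first by rewrite divr_ge0 // ltW.
have D0 := enorm_ge0 (z - x0).
have [Dr|rD] := ltP (enorm (z - x0)) r.
  have := near_x0 _ zf Dr.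
  have : 0 <= 2 / r * enorm (z - x0) by rewrite mulr_ge0 // divr_ge0 // ltW.
  lra.
set D := enorm (z - x0) in rD D0 *.
have Dp : 0 < D by apply: lt_le_trans rD.
(* The point w below lies at distance s * D = r / 2 from x0. *)
pose s := r / (2 * D).
have sD : s * D = r / 2 by rewrite /s; field; rewrite gt_eqF.
have s0 : 0 < s by rewrite divr_gt0 // mulr_gt0.
have s1 : s <= 1 by rewrite ler_pdivrMr ?mulr_gt0 //; lra.
have [] := @edom_conv z x0 s _ zf x0f; first by rewrite ltW.
set w := _ + _ => wf fw.
have : fine (f x0) - 1 < fine (f w).
  apply: near_x0 => //.
  have -> : w - x0 = s *: (z - x0).
    by rewrite /w scalerBl scale1r scalerBr -addrA [x0 - _]addrC addrK.
  by rewrite enormZ gtr0_norm // -/D sD; lra.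
move=> h.
have {fw}h : s * fine (f x0) - 1 < s * fine (f z) by lra.
have -> : 2 / r * D = s^-1.
  by rewrite /s; field; rewrite !gt_eqF.
rewrite -(ler_pM2l s0) 2!mulrBr mulfV ?gt_eqF //; lra.
Qed.

Variables (t : R) (x : 'rV[R]_n).
Hypothesis t0 : 0 < t.

Let k := (2 * t)^-1.
Let Phi z := fine (f z) + k * enorm (z - x) ^+ 2.

Let k0 : 0 < k. Proof. by rewrite invr_gt0 mulr_gt0. Qed.

Lemma prox_objective_has_inf : has_inf [set Phi z | z in edom f].
Proof.
have [x0 x0f] := f_proper.2; split; first by exists (Phi x0), x0.
have [B B0 fB] := affine_minorant x0f.
exists (fine (f x0) - 1 - B * enorm (x - x0) - B ^+ 2 / (4 * k)).
move=> _ [z zf <-]; rewrite /Phi.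
have := fB _ zf.
have : enorm (z - x0) <= enorm (z - x) + enorm (x - x0).
  by have := enormD (z - x) (x - x0); rewrite addrA subrK.
move=> /(ler_wpM2l B0).
set D := enorm (z - x).
have : 0 <= k * (D - B / (2 * k)) ^+ 2 by rewrite mulr_ge0 ?sqr_ge0 ?ltW.
have -> : k * (D - B / (2 * k)) ^+ 2 = k * D ^+ 2 - B * D + B ^+ 2 / (4 * k).
  by field; rewrite gt_eqF.
lra.
Qed.

Let mu := inf [set Phi z | z in edom f].

(** Compare the infimum with the midpoint of a and b: strong convexity turns
    almost minimal values into close points, so that minimizing sequences are
    Cauchy. *)
Lemma prox_objective_near_min (e : R) a b : edom f a -> edom f b ->
  Phi a <= mu + e -> Phi b <= mu + e -> enorm (a - b) ^+ 2 <= 4 * e / k.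
Proof.
move=> af bf ae be.
have h01 : 0 <= (2^-1 : R) <= 1 by rewrite invr_ge0 ler0n invf_le1 ?ler1n.
have [mf fm] := edom_conv h01 af bf.
have := inf_lbound prox_objective_has_inf.2 (imageP Phi mf).
rewrite -/mu /Phi.
have -> : 2^-1 *: a + (1 - 2^-1) *: b - x =
    2^-1 *: (a - x) + (1 - 2^-1) *: (b - x).
  by rewrite !scalerBr addrACA -opprD -scalerDl addrCA subrr addr0 scale1r.
rewrite enorm_sqr enorm_conv -!enorm_sqr.
have -> : a - x - (b - x) = a - b by rewrite opprB addrA subrK.
move: ae be fm; rewrite /Phi ler_pdivlMr // => ae be fm.
lra.
Qed.

(** A minimizing sequence is Cauchy and converges to some p; lower semicontinuity
    of f and continuity of the quadratic term make p a minimizer.  Completeness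
    replaces compactness here. *)
Lemma prox_objective_argmin : exists2 p, edom f p &
  forall z, edom f z -> Phi p <= Phi z.
Proof.
have /choice[u uP] : forall i, exists z, edom f z /\ Phi z < mu + i.+1%:R^-1.
  move=> i; have i0 : 0 < i.+1%:R^-1 :> R by rewrite invr_gt0.
  by have [_ [z zf <-] ze] := inf_adherent i0 prox_objective_has_inf; exists z.
have small e : 0 < e -> exists N, forall i, (N <= i)%N -> i.+1%:R^-1 < e :> R.
  move=> e0; exists (Num.truncn e^-1) => i Ni.
  rewrite invf_plt ?posrE //; apply: (lt_le_trans (truncnS_gt _)).
  by rewrite ler_nat ltnS.
have /cauchy_cvgP : cauchy (u @ \oo).
  apply: cauchy_exP => e e0.
  have /small[N uN] : 0 < k * e ^+ 2 / 8 by rewrite divr_gt0 ?mulr_gt0 ?exprn_gt0.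
  exists (u N); exists N => //= i /= Ni.
  rewrite -ball_normE /ball_ /= (le_lt_trans (sup_norm_le _)) //.
  rewrite -(@ltr_pXn2r _ 2) ?nnegrE ?enorm_ge0 ?ltW //.
  have close j : (N <= j)%N -> Phi (u j) <= mu + k * e ^+ 2 / 8.
    move=> Nj; apply/ltW/(lt_trans (uP j).2).
    by rewrite ltrD2l uN.
  apply: (le_lt_trans (prox_objective_near_min (uP N).1 (uP i).1
    (close _ (leqnn N)) (close _ Ni))).
  have -> : 4 * (k * e ^+ 2 / 8) / k = e ^+ 2 / 2 by field; rewrite gt_eqF.
  by have : 0 < e ^+ 2 := exprn_gt0 _ e0; lra.
move=> /cvg_ex[/= p up].
suff fp : (f p <= (mu - k * enorm (p - x) ^+ 2)%:E)%E.
  have pf : edom f p by rewrite /edom /= (le_lt_trans fp) ?ltry.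
  exists p => // z zf.
  have := inf_lbound prox_objective_has_inf.2 (imageP Phi zf); rewrite -/mu.
  by move: fp; rewrite -[f p]fineK ?fin_num_edom // lee_fin /Phi; lra.
rewrite leNgt; apply/negP => fp.
have [s ms sp] : exists2 s, mu - k * enorm (p - x) ^+ 2 < s & (s%:E < f p)%E.
  case: (f p) fp => [r| |]; rewrite ?ltNge ?leNye // -?ltNge => fp.
    rewrite lte_fin in fp; exists ((mu - k * enorm (p - x) ^+ 2 + r) / 2); rewrite ?lte_fin; lra.
  by exists (mu - k * enorm (p - x) ^+ 2 + 1); rewrite ?ltry //; lra.
have [V pV fV] := f_lsc sp.
pose e := (s - (mu - k * enorm (p - x) ^+ 2)) / 2.
have e0 : 0 < e by rewrite /e; lra.
have uV : \forall i \near \oo, V (u i) by exact: up.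
have ud : \forall i \near \oo,
    `|enorm (p - x) ^+ 2 - enorm (u i - x) ^+ 2| < e / k.
  have cv : enorm (u i - x) ^+ 2 @[i --> \oo] --> enorm (p - x) ^+ 2.
    exact: continuous_cvg _ (@continuous_sqr_dist _ _ x p) up.
  by move/cvgrPdist_lt : cv; apply; rewrite divr_gt0.
have [N uN] := small _ e0.
have ue : \forall i \near \oo, i.+1%:R^-1 < e :> R by exists N.
have [i [[Vi di] ei]] :
    exists i, (V (u i) /\ `|enorm (p - x) ^+ 2 - enorm (u i - x) ^+ 2| < e / k) /\
      i.+1%:R^-1 < e.
  by near \oo => i; exists i; split; [split|]; near: i.
have [uif ui] := uP i.
have {ui} : Phi (u i) < mu + e by apply: (lt_trans ui); rewrite ltrD2l.
have := fV _ Vi; rewrite -[f _]fineK ?fin_num_edom // lte_fin.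
move: di; rewrite ltr_norml ltr_pdivlMr // /Phi /e => /andP[_]; lra.
Unshelve. all: by end_near. Qed.

Lemma argmin_prox_objective :
  argmin_set (fun z => f z + (k * enorm (z - x) ^+ 2)%:E)%E !=set0.
Proof.
have [p pf pmin] := prox_objective_argmin; exists p => z.
have [zf|] := pselect (edom f z).
  rewrite -(fineK (fin_num_edom pf)) -(fineK (fin_num_edom zf)) -!EFinD lee_fin.
  exact: pmin.
rewrite /edom /= => /negP; rewrite ltey negbK => /eqP ->.
by rewrite addye // leey.
Qed.

(** The inequality says that (x - p) / t is a subgradient of f at p.  It follows by
    comparing p with p + s (z - p), dividing by s and letting s tend to 0. *)
Lemma prox_spec : let p := prox t f x in edom f p /\
  forall z, edom f z -> fine (f p) + t^-1 * dot (x - p) (z - p) <= fine (f z).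
Proof.
move=> p.
have pmin : argmin_set (fun z => f z + (k * enorm (z - x) ^+ 2)%:E)%E p.
  by rewrite /p /prox /argmin -/k; apply: xgetPex; exact: argmin_prox_objective.
have pf : edom f p.
  have [x0 x0f] := f_proper.2; have := pmin x0; rewrite /edom /= !ltey => h.
  apply/eqP => fp; move: h; rewrite fp addye // leye_eq.
  by rewrite -(fineK (fin_num_edom x0f)) -EFinD.
split=> // z zf; set a := dot _ _.
have step s : 0 < s -> s <= 1 ->
    fine (f p) + t^-1 * a - s * (k * enorm (z - p) ^+ 2) <= fine (f z).
  move=> s0 s1.
  have [|wf fw] := @edom_conv z p s _ zf pf; first by rewrite ltW.
  have := pmin (s *: z + (1 - s) *: p).
  rewrite -(fineK (fin_num_edom pf)) -(fineK (fin_num_edom wf)) -!EFinD lee_fin.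
  have -> : s *: z + (1 - s) *: p - x = s *: (z - p) + (p - x).
    rewrite scalerBl scale1r scalerBr addrA -!addrA; congr (_ + _).
    by rewrite addrCA addrA.
  move=> h.
  have tk : t^-1 = 2 * k by rewrite /k; field; rewrite gt_eqF.
  rewrite -subr_ge0 -(pmulr_rge0 _ s0) tk.
  move: h fw; rewrite !enorm_sqr /a !dotE (dotC p z) (dotC p x) (dotC x z).
  lra.
apply/ler_addgt0Pr => e e0.
have K0 : 0 <= k * enorm (z - p) ^+ 2 by rewrite mulr_ge0 ?sqr_ge0 ?ltW.
(* The + 1 keeps the denominator positive when z = p. *)
pose s := Num.min 1 (e / (k * enorm (z - p) ^+ 2 + 1)).
have s0 : 0 < s by rewrite lt_min ltr01 divr_gt0 // ltr_wpDl.
have s1 : s <= 1 by rewrite ge_min lexx.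
have : s * (k * enorm (z - p) ^+ 2) <= e.
  have : s <= e / (k * enorm (z - p) ^+ 2 + 1) by rewrite ge_min lexx orbT.
  by rewrite ler_pdivlMr ?ltr_wpDl //; nra.
by have := step s s0 s1; lra.
Qed.

End ProximalPoint.

Section Closedness.
Variables (R : realType) (n : nat).

Lemma closed_fun_lsc (f : 'rV[R]_n -> \bar R) :
  closed_fun f -> lower_semicontinuous f.
Proof.
move=> fcl x a ax.
have : nbhs (x, a) (~` epigraph f).
  apply: open_nbhs_nbhs; split; first exact: closed_openC.
  by rewrite /epigraph /= leNgt ax.
move=> [[V W] /= [xV aW] VW]; exists V => // y Vy.
rewrite ltNge; apply/negP => fy; apply: (VW (y, a)) => //.
by split => //=; exact: nbhs_singleton.
Qed.

Lemma lscD_continuous (f : 'rV[R]_n -> \bar R) (k : 'rV[R]_n -> R) :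
  lower_semicontinuous f -> continuous k ->
  lower_semicontinuous (fun z => f z + (k z)%:E)%E.
Proof.
move=> flsc kcont x a ax.
have [s sx as_] : exists2 s, (s%:E < f x)%E & a - k x < s.
  case: (f x) ax => [r| |]; rewrite ?ltNge ?leNye // -?ltNge => ax.
    by exists ((a - k x + r) / 2); rewrite -?EFinD ?lte_fin in ax *; lra.
  by exists (a - k x + 1); rewrite ?ltry //; lra.
have [V xV fV] := flsc _ _ sx.
have kV : nbhs x [set y | a - s < k y].
  have : nbhs (k x) [set r | a - s < r].
    by apply: open_nbhs_nbhs; split; [exact: open_gt|rewrite /=; lra].
  exact: (kcont x).
exists (V `&` [set y | a - s < k y]); first exact: filterI.
move=> y [Vy /= ky]; have := fV _ Vy.
case: (f y) => [r| |]; rewrite ?ltNge ?leNye // -?ltNge ?lte_fin ?addye ?ltry //.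
by rewrite -?EFinD ?lte_fin; lra.
Qed.

End Closedness.

(** * The Moreau envelope of a Lipschitz convex function *)

Section MoreauEnvelope.
Variables (R : realType) (m : nat) (h : 'rV[R]_m -> R) (L nu : R).
Hypotheses (h_convex : convex_function setT h)
  (h_lip : forall u v, `|h u - h v| <= L * enorm (u - v)) (nu0 : 0 < nu).

Lemma convex_function_segment u v (s : R) : 0 <= s <= 1 ->
  h (s *: u + (1 - s) *: v) <= s * h u + (1 - s) * h v.
Proof.
move=> /andP[s0 s1].
by have := h_convex (Itv01 s0 s1) (mem_set (I : setT u)) (mem_set (I : setT v)).
Qed.

Lemma lipschitz_continuous : continuous h.
Proof.
have LL (v : 'rV[R]_m) : L * enorm v <= `|L| * enorm v by rewrite ler_wpM2r ?enorm_ge0 ?ler_norm.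
move=> u; apply/(@cvgrPdist_lt _ _ _ (nbhs u)) => e e0.
have : (fun v => enorm (v - u) ^+ 2) @ u --> enorm (u - u) ^+ 2.
  exact: continuous_sqr_dist.
pose r := e / (`|L| + 1).
have r0 : 0 < r by rewrite divr_gt0 // ltr_wpDl.
rewrite subrr enorm_sqr dot0l => /(@cvgrPdist_lt _ _ _ (nbhs u)) /(_ _ (exprn_gt0 2 r0)).
apply: filterS => v; rewrite sub0r normrN ger0_norm ?sqr_ge0 //.
rewrite ltr_pXn2r ?nnegrE ?enorm_ge0 ?ltW // /r ltr_pdivlMr ?ltr_wpDl // => vr.
apply: le_lt_trans (h_lip _ _) _; have := LL (u - v).
by rewrite -(enormN (u - v)) opprB; have := enorm_ge0 (v - u); lra.
Qed.

Let hE u : \bar R := (h u)%:E.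
Let P := prox nu hE.

Lemma prox_outer_subgradient u v :
  h (P u) + nu^-1 * dot (u - P u) (v - P u) <= h v.
Proof.
have hp : proper_fun hE by split=> //; exists 0; rewrite /edom /= /hE ltry.
have hl : lower_semicontinuous hE.
  move=> w a; rewrite lte_fin => aw.
  have : nbhs (h w) [set r | a < r].
    by apply: open_nbhs_nbhs; split; [exact: open_gt|].
  by move=> /lipschitz_continuous ?; exists (h @^-1` [set r | a < r]).
have hc : convex_efun hE.
  by move=> a b s s01; rewrite /hE -!EFinM -EFinD lee_fin convex_function_segment.
have [_ /(_ v)] := prox_spec hp hl hc u nu0.
by apply; rewrite /edom /= /hE ltry.
Qed.

Definition moreau_env u : R := h (P u) + (2 * nu)^-1 * enorm (u - P u) ^+ 2.

Definition moreau_grad u : 'rV[R]_m := nu^-1 *: u - nu^-1 *: P u.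

Let k2 : (2 * nu)^-1 = nu^-1 / 2. Proof. by rewrite invfM mulrC. Qed.

Lemma moreau_env_le u : moreau_env u <= h u.
Proof.
have := prox_outer_subgradient u u; rewrite /moreau_env k2 enorm_sqr.
have : 0 <= nu^-1 * dot (u - P u) (u - P u).
  by rewrite mulr_ge0 ?dot_ge0 // invr_ge0 ltW.
lra.
Qed.

(** By the arithmetic-geometric inequality, L |u - P u| is at most
    |u - P u|^2 / (2 nu) + nu L^2 / 2. *)
Lemma le_moreau_env u : h u <= moreau_env u + nu * L ^+ 2 / 2.
Proof.
have : h u - h (P u) <= L * enorm (u - P u).
  exact: le_trans (ler_norm _) (h_lip _ _).
rewrite /moreau_env k2; set D := enorm _.
have : 0 <= nu^-1 * (D - nu * L) ^+ 2 by rewrite mulr_ge0 ?sqr_ge0 // invr_ge0 ltW.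
have -> : nu^-1 * (D - nu * L) ^+ 2 = nu^-1 * D ^+ 2 - 2 * (L * D) + nu * L ^+ 2.
  by field; rewrite gt_eqF.
lra.
Qed.

(** This strengthened gradient inequality yields both the convexity of the
    envelope (drop the square) and its smoothness (exchange u and v, then complete
    the square). *)
Lemma moreau_env_convex_smooth u v :
  moreau_env u + dot (moreau_grad u) (v - u) +
    nu / 2 * enorm (moreau_grad u - moreau_grad v) ^+ 2 <= moreau_env v.
Proof.
have := prox_outer_subgradient u (P v).
rewrite /moreau_env /moreau_grad k2 -!scalerBr.
rewrite !enormZ gtr0_norm ?invr_gt0 // exprMn.
have -> a : nu / 2 * (nu^-1 ^+ 2 * a) = nu^-1 / 2 * a.
  by field; rewrite gt_eqF.
move: (P u) (P v) (nu^-1) => p q j; rewrite (enorm_sqr (u - p)).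
rewrite (enorm_sqr (v - q)) (enorm_sqr (u - p - (v - q))) !dotE.
rewrite ?(dotC v u) ?(dotC p u) ?(dotC q u) ?(dotC p v) ?(dotC q v) ?(dotC q p).
lra.
Qed.

Lemma moreau_env_ge_linear u v :
  moreau_env u + dot (moreau_grad u) (v - u) <= moreau_env v.
Proof.
apply: le_trans (moreau_env_convex_smooth u v); rewrite lerDl.
by rewrite mulr_ge0 ?sqr_ge0 // divr_ge0 // ltW.
Qed.

Lemma moreau_env_le_quadratic u v :
  moreau_env v <= moreau_env u + dot (moreau_grad u) (v - u) +
    nu^-1 / 2 * enorm (v - u) ^+ 2.
Proof.
have := moreau_env_convex_smooth v u.
move: (moreau_grad u) (moreau_grad v) (moreau_env u) (moreau_env v) => a b eu ev.
have : 0 <= nu^-1 / 2 * dot (nu *: (b - a) - (v - u)) (nu *: (b - a) - (v - u)).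
  by rewrite mulr_ge0 ?dot_ge0 // divr_ge0 // invr_ge0 ltW.
have -> (x y : 'rV[R]_m) : dot (nu *: x - y) (nu *: x - y) =
    nu ^+ 2 * dot x x - 2 * (nu * dot x y) + dot y y.
  by rewrite !dotE (dotC y x); ring.
rewrite -(opprB v u) dotNr (dotDl b (- a) (v - u)) (dotNl a (v - u)).
rewrite (enorm_sqr (b - a)) (enorm_sqr (v - u)) 2!mulrDr.
have -> : nu^-1 / 2 * (nu ^+ 2 * dot (b - a) (b - a)) =
  nu / 2 * dot (b - a) (b - a) by field; rewrite gt_eqF.
have -> : nu^-1 / 2 * - (2 * (nu * (dot b (v - u) - dot a (v - u)))) =
  dot a (v - u) - dot b (v - u) by field; rewrite gt_eqF.
lra.
Qed.


End MoreauEnvelope.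

(** * The accelerated proximal gradient method *)

Section AcceleratedProximalGradient.
Variables (R : realType) (n : nat) (psi : 'rV[R]_n -> \bar R).
Variables (phi : 'rV[R]_n -> R) (grad : 'rV[R]_n -> 'rV[R]_n) (M : R).

(** The a_j of an accelerated scheme: their partial sums are
    A_j = j (j + 1) / 4, they satisfy a_j^2 <= A_{j+1}, and
    [apg_theta] j = a_j / A_{j+1}. *)
Definition apg_weight (j : nat) : R := j.+1%:R / 2.

Definition apg_theta (j : nat) : R := 2 / j.+2%:R.

(** The pair consists of the main iterate and the proximal (mirror) iterate. *)
Definition apg_step (j : nat) (s : 'rV[R]_n * 'rV[R]_n) :=
  let y := (1 - apg_theta j) *: s.1 + apg_theta j *: s.2 in
  let t := apg_weight j / M in
  let v := prox t psi (s.2 - t *: grad y) in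
  ((1 - apg_theta j) *: s.1 + apg_theta j *: v, v).

Fixpoint apg (k : nat) (x0 : 'rV[R]_n) : 'rV[R]_n * 'rV[R]_n :=
  if k is j.+1 then apg_step j (apg j x0) else (x0, x0).

Hypotheses (psi_proper : proper_fun psi) (psi_lsc : lower_semicontinuous psi)
  (psi_convex : convex_efun psi) (M0 : 0 < M).
Hypothesis phi_ge_linear : forall y z, phi y + dot (grad y) (z - y) <= phi z.
Hypothesis phi_le_quadratic : forall y z,
  phi z <= phi y + dot (grad y) (z - y) + M / 2 * enorm (z - y) ^+ 2.

Let Psi z := fine (psi z) + phi z.
Let A (j : nat) : R := (j * j.+1)%:R / 4.

(** The potential A_j (Psi x - Psi z) + M/2 |z - v|^2 decreases.  The quadratic
    upper bound at y costs A_{j+1} theta^2 M/2 |v' - v|^2 <= M/2 |v' - v|^2, which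
    the proximal inequality for v', weighted by a_j, pays back through the
    three-point identity.  The comparison point z need not be a minimizer, and the
    sign of Psi x - Psi z does not matter. *)
Lemma apg_step_potential j x v z : edom psi x -> edom psi z ->
  edom psi (apg_step j (x, v)).1 /\
  A j.+1 * (Psi (apg_step j (x, v)).1 - Psi z) +
    M / 2 * enorm (z - (apg_step j (x, v)).2) ^+ 2 <=
  A j * (Psi x - Psi z) + M / 2 * enorm (z - v) ^+ 2.
Proof.
move=> xf zf; rewrite /apg_step /=.
set th := apg_theta j; set a := apg_weight j; set t := a / M.
set y := (1 - th) *: x + th *: v; set v' := prox _ _ _.
have j0 : 0 <= j%:R :> R by rewrite ler0n.
have a0 : 0 < a by rewrite divr_gt0 // ltr0n.
have aE : a = th * A j.+1.
  rewrite /a /th /apg_weight /apg_theta /A natrM -!natr1; field.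
  by rewrite gt_eqF //; lra.
have AE : A j = (1 - th) * A j.+1.
  rewrite /th /apg_theta /A !natrM -!natr1; field.
  by rewrite gt_eqF //; lra.
have A0 : 0 < A j.+1 by rewrite divr_gt0 // ltr0n.
have th0 : 0 < th by rewrite divr_gt0 // ltr0n.
have th1 : th <= 1 by rewrite ler_pdivrMr ?ltr0n // mul1r ler_nat.
have ath : a * th <= 1.
  rewrite /a /th /apg_weight /apg_theta -[j.+2%:R]natr1 -[j.+1%:R]natr1.
  have -> : (j%:R + 1) / 2 * (2 / (j%:R + 1 + 1)) = (j%:R + 1) / (j%:R + 1 + 1) :> R.
    by field; rewrite gt_eqF //; lra.
  by rewrite ler_pdivrMr; lra.
have t0 : 0 < t by rewrite divr_gt0.
have atM : a * t^-1 = M by rewrite /t; field; rewrite !gt_eqF.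
have Mta : M * t = a by rewrite /t; field; rewrite gt_eqF.
have [vf /(_ z zf)] := prox_spec psi_proper psi_lsc psi_convex (v - t *: grad y) t0.
rewrite -/v' in vf * => proxz.
clearbody v' t a th.
have [|x'f psix'] := edom_conv psi_proper psi_convex (s := 1 - th) _ xf vf.
  by rewrite subr_ge0 th1 /= gerBl ltW.
rewrite (_ : 1 - (1 - th) = th) in x'f psix'; last by ring.
have [x' x'E] : exists x', x' = (1 - th) *: x + th *: v' by eexists.
rewrite -x'E in x'f psix' *; split; first exact: x'f.
have x'y : x' - y = th *: (v' - v).
  by rewrite x'E /y opprD addrACA subrr add0r scalerBr.
have upper := phi_le_quadratic y x'.
have lowx := phi_ge_linear y x.
have lowz := phi_ge_linear y z.
have lin : dot (grad y) (x' - y) =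
    (1 - th) * dot (grad y) (x - y) + th * dot (grad y) (v' - y).
  by rewrite x'E !dotE; ring.
rewrite lin x'y enormZ gtr0_norm // exprMn in upper.
have proxz' : a * fine (psi v') + M * dot (v - v') (z - v') -
    a * dot (grad y) (z - v') <= a * fine (psi z).
  rewrite -(ler_pM2l a0) in proxz; apply: le_trans proxz.
  rewrite mulrDr -addrA lerD2l mulrA.
  rewrite atM; have -> : v - t *: grad y - v' = (v - v') - t *: grad y by rewrite addrAC.
  by rewrite [in leRHS]dotDl dotNl dotZl mulrBr mulrA Mta.
have three : enorm (z - v) ^+ 2 =
    enorm (z - v') ^+ 2 - 2 * dot (v - v') (z - v') + enorm (v' - v) ^+ 2.
  rewrite !enorm_sqr !dotE (dotC v z) (dotC v' z) (dotC v' v); ring.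
have gz : dot (grad y) (z - y) = dot (grad y) (z - v') + dot (grad y) (v' - y).
  by rewrite -dotDr addrA subrK.
have quad : A j.+1 * (M / 2 * (th ^+ 2 * enorm (v' - v) ^+ 2)) <=
    M / 2 * enorm (v' - v) ^+ 2.
  have -> : A j.+1 * (M / 2 * (th ^+ 2 * enorm (v' - v) ^+ 2)) =
     a * th * (M / 2 * enorm (v' - v) ^+ 2) by rewrite aE; ring.
  by rewrite ler_piMl // mulr_ge0 ?sqr_ge0 // divr_ge0 // ltW.
rewrite /Psi AE.
have u1 := ler_wpM2l (ltW A0) upper.
have u2 := ler_wpM2l (ltW A0) psix'.
have u3 : (1 - th) * A j.+1 * (phi y + dot (grad y) (x - y)) <=
  (1 - th) * A j.+1 * phi x.
  by rewrite ler_wpM2l // mulr_ge0 ?subr_ge0 // ltW.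
have u4 := ler_wpM2l (ltW a0) lowz.
rewrite gz in u4; rewrite three.
move: u1 u2 u3 u4 quad proxz'; rewrite aE.
(* What remains is linear once y and A are opaque. *)
clear -R; clearbody y A; lra.
Qed.

(** Since A_0 = 0, the initial value Psi x0 drops out of the telescoped
    potential: only the distance from x0 to z remains. *)
Lemma apg_rate k x0 z : edom psi x0 -> edom psi z -> (0 < k)%N ->
  edom psi (apg k x0).1 /\
  Psi (apg k x0).1 <= Psi z + 2 * M / (k * k.+1)%:R * enorm (z - x0) ^+ 2.
Proof.
move=> x0f zf k0.
have [xf] : edom psi (apg k x0).1 /\
    A k * (Psi (apg k x0).1 - Psi z) + M / 2 * enorm (z - (apg k x0).2) ^+ 2 <=
    M / 2 * enorm (z - x0) ^+ 2.
  elim: k {k0} => [|j [xf IH]] /=; first by rewrite /A mul0n !mul0r add0r.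
  case: (apg j x0) xf IH => x v /= xf IH.
  have [x'f step] := apg_step_potential j v xf zf.
  by split=> //; apply: le_trans IH.
have : 0 <= M / 2 * enorm (z - (apg k x0).2) ^+ 2.
  by rewrite mulr_ge0 ?sqr_ge0 // divr_ge0 // ltW.
have K0 : 0 < (k * k.+1)%:R :> R by rewrite ltr0n muln_gt0 k0.
move=> h0 h; split=> //.
have {h0}h : A k * (Psi (apg k x0).1 - Psi z) <= M / 2 * enorm (z - x0) ^+ 2.
  by apply: le_trans h; rewrite lerDl.
rewrite -lerBlDl -(@ler_pM2l _ (A k)); last by rewrite divr_gt0.
apply: (le_trans h); rewrite le_eqVlt; apply/orP; left; apply/eqP.
rewrite /A; move: (k * k.+1)%:R K0 (enorm _ ^+ 2) => K K0 E.
by field; rewrite gt_eqF.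
Qed.

End AcceleratedProximalGradient.

(** * The prox-linear model and its inexact minimization *)

Section ProxLinearStep.
Variables (R : realType) (d m : nat).
Variables (g : 'rV[R]_d -> \bar R) (h : 'rV[R]_m -> R) (c : 'rV[R]_d -> 'rV[R]_m).
Variables (L beta : R).
Hypotheses (problem : composite_problem g h c L beta) (L0 : 0 < L) (beta0 : 0 < beta).

Let mu := L * beta.
Let mu0 : 0 < mu. Proof. exact: mulr_gt0. Qed.

Let g_proper := reg_proper problem.
Let g_lsc := closed_fun_lsc (reg_closed problem).
Let g_convex := reg_convex problem.
Let h_convex := outer_convex problem.
Let h_lip := outer_lipschitz problem.

Variable y : 'rV[R]_d.
Hypothesis yg : edom g y.

Definition linearization z : 'rV[R]_m := c y + (z - y) *m jacobian c y.

Definition model_value z : R :=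
  fine (g z) + h (linearization z) + mu / 2 * enorm (z - y) ^+ 2.

Lemma linearizationB z w :
  linearization z - linearization w = (z - w) *m jacobian c y.
Proof.
by rewrite /linearization opprD addrACA subrr add0r -mulmxBl opprB addrA subrK.
Qed.

Lemma linearization_conv (s : R) z w :
  linearization (s *: z + (1 - s) *: w) =
  s *: linearization z + (1 - s) *: linearization w.
Proof.
have lin0 v : linearization v = linearization w + (v - w) *m jacobian c y.
  by rewrite -linearizationB addrC subrK.
rewrite (lin0 (_ + _)) (lin0 z).
have -> : s *: z + (1 - s) *: w - w = s *: (z - w).
  by rewrite scalerBl scale1r scalerBr -addrA [w - _]addrC addrK.
rewrite -scalemxAl scalerDr; move: (_ *m _) (linearization w) => q l.
by rewrite scalerBl scale1r [RHS]addrC addrA subrK.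
Qed.

Lemma model_majorizes z :
  h (c z) <= h (linearization z) + mu / 2 * enorm (z - y) ^+ 2.
Proof.
rewrite -lerBlDl; apply: le_trans (ler_norm _) _.
apply: le_trans (h_lip _ _) _.
have -> : mu / 2 * enorm (z - y) ^+ 2 = L * (beta / 2 * enorm (z - y) ^+ 2).
  by rewrite /mu !mulrA.
rewrite ler_wpM2l ?(ltW L0) //; apply: linearization_error => //; first exact: ltW.
- exact: inner_differentiable problem.
- exact: inner_smooth problem.
Qed.

Lemma linearized_outer_continuous : continuous (fun z => h (linearization z)).
Proof.
apply: (@lipschitz_continuous _ _ _ (L * opnorm (jacobian c y))) => u v.
apply: le_trans (h_lip _ _) _; rewrite -mulrA ler_wpM2l ?(ltW L0) //.
by rewrite linearizationB enorm_mulmx.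
Qed.

Let f z := (g z + (h (linearization z))%:E)%E.

Let f_proper : proper_fun f.
Proof.
split=> [z|].
  by move: (g_proper.1 z); rewrite /f; case: (g z).
by exists y; rewrite /edom /= /f lte_add_pinfty ?ltry.
Qed.

Let edomE z : edom f z <-> edom g z.
Proof.
rewrite /edom /= /f; case: (g z) => [r| |]; rewrite -?EFinD ?addye ?addNye //.
by rewrite !ltry.
Qed.

Let f_fine z : edom g z -> fine (f z) = fine (g z) + h (linearization z).
Proof. by move=> zg; rewrite /f fineD ?fin_num_edom. Qed.

Let f_convex : convex_efun f.
Proof.
move=> a b s s01; have hab : h (linearization (s *: a + (1 - s) *: b)) <=
    s * h (linearization a) + (1 - s) * h (linearization b).
  by rewrite linearization_conv; exact: convex_function_segment.
have := g_convex a b s01; rewrite /f.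
have /andP[s0 s1] := s01.
have s1' : 0 <= 1 - s by rewrite subr_ge0.
rewrite muleDr ?fin_num_adde_defl // muleDr ?fin_num_adde_defl // addeACA -!EFinM.
by move=> gab; rewrite leeD // -EFinD lee_fin.
Qed.

(** The model is the proximal objective at y of the closed convex function
    f = g + h o linearization, so its minimizer S satisfies [prox_spec], and the
    quadratic term turns that inequality into strong convexity at S. *)
Lemma prox_linear_step_spec (S := prox_linear_step g h c mu^-1 y) :
  edom g S /\ forall z, edom g z ->
    model_value S + mu / 2 * enorm (z - S) ^+ 2 <= model_value z.
Proof.
have -> : S = prox mu^-1 f y.
  rewrite /S /prox_linear_step /prox; congr argmin; apply/funext => z.
  by rewrite /prox_linear_model /f EFinD addeA.
have muV0 : 0 < mu^-1 by rewrite invr_gt0.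
have f_lsc := lscD_continuous g_lsc linearized_outer_continuous.
have [/edomE Sg Smin] := prox_spec f_proper f_lsc f_convex y muV0.
split=> // z zg; have := Smin z ((edomE z).2 zg); rewrite invrK.
rewrite /model_value (f_fine Sg) (f_fine zg).
move: (prox mu^-1 f y) => p.
have -> : enorm (z - y) ^+ 2 =
    enorm (z - p) ^+ 2 - 2 * dot (y - p) (z - p) + enorm (p - y) ^+ 2.
  by rewrite !enorm_sqr !dotE (dotC y z) (dotC p z) (dotC p y); ring.
move: (fine _) (fine _) (h _) (h _) => *; clearbody mu; lra.
Qed.

Variables (normJ nu : R).
Hypotheses (normJ0 : 0 < normJ) (Jy : opnorm (jacobian c y) <= normJ)
  (nu0 : 0 < nu).

(** The part of the model that is differentiated: the quadratic term is kept with
    the smoothed outer function, so that only [prox] of g itself is needed. *)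
Definition smooth_model z : R :=
  moreau_env h nu (linearization z) + mu / 2 * enorm (z - y) ^+ 2.

Definition smooth_model_grad z : 'rV[R]_d :=
  moreau_grad h nu (linearization z) *m (jacobian c y)^T + mu *: (z - y).

Definition smooth_model_curvature : R := normJ ^+ 2 / nu + mu.

Lemma smooth_model_ge_linear w z :
  smooth_model w + dot (smooth_model_grad w) (z - w) <= smooth_model z.
Proof.
have := moreau_env_ge_linear h_convex h_lip nu0 (linearization w) (linearization z).
rewrite linearizationB -dot_adjoint /smooth_model /smooth_model_grad.
move: (moreau_env _ _ _) (moreau_env _ _ _) (_ *m _) => e1 e2 q.
have -> : enorm (z - y) ^+ 2 =
    enorm (w - y) ^+ 2 + 2 * dot (w - y) (z - w) + enorm (z - w) ^+ 2.
  by rewrite !enorm_sqr !dotE (dotC y z) (dotC w z) (dotC w y); ring.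
have : 0 <= mu / 2 * enorm (z - w) ^+ 2 by rewrite mulr_ge0 ?sqr_ge0 // divr_ge0 // ltW.
rewrite (dotDl q) dotZl; move: (dot _ _) (dot _ _) (enorm _ ^+ 2) (enorm _ ^+ 2).
clearbody mu => *; lra.
Qed.

Lemma smooth_model_le_quadratic w z :
  smooth_model z <= smooth_model w + dot (smooth_model_grad w) (z - w) +
    smooth_model_curvature / 2 * enorm (z - w) ^+ 2.
Proof.
have := moreau_env_le_quadratic h_convex h_lip nu0 (linearization w) (linearization z).
rewrite linearizationB -dot_adjoint /smooth_model /smooth_model_grad.
have : nu^-1 / 2 * enorm ((z - w) *m jacobian c y) ^+ 2 <=
    nu^-1 / 2 * (normJ ^+ 2 * enorm (z - w) ^+ 2).
  rewrite ler_wpM2l ?divr_ge0 ?invr_ge0 ?(ltW nu0) // -exprMn.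
  rewrite ler_pXn2r ?nnegrE ?mulr_ge0 ?enorm_ge0 ?(ltW normJ0) //.
  apply: le_trans (enorm_mulmx _ _) _.
  by rewrite ler_wpM2r ?enorm_ge0.
rewrite /smooth_model_curvature.
move: (moreau_env _ _ _) (moreau_env _ _ _) (_ *m _^T) => e1 e2 q.
have -> : enorm (z - y) ^+ 2 =
    enorm (w - y) ^+ 2 + 2 * dot (w - y) (z - w) + enorm (z - w) ^+ 2.
  by rewrite !enorm_sqr !dotE (dotC y z) (dotC w z) (dotC w y); ring.
rewrite (dotDl q) dotZl; move: (enorm (_ *m _) ^+ 2) => E.
move: (dot _ _) (dot _ _) (enorm _ ^+ 2) (enorm _ ^+ 2) (nu^-1) (normJ ^+ 2).
clearbody mu => *; lra.
Qed.

Definition inexact_step k : 'rV[R]_d :=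
  (apg g smooth_model_grad smooth_model_curvature k y).1.

(** The comparison point in [apg_rate] is the minimizer S of the original model,
    which makes the error relative to |S - y|^2; passing from h to its envelope
    and back costs nu L^2 / 2 once. *)
Lemma inexact_step_spec k (S := prox_linear_step g h c mu^-1 y) : (0 < k)%N ->
  edom g (inexact_step k) /\
  model_value (inexact_step k) <= model_value S +
    2 * smooth_model_curvature / (k * k.+1)%:R * enorm (S - y) ^+ 2 +
    nu * L ^+ 2 / 2.
Proof.
move=> k0; have [Sg _] := prox_linear_step_spec.
have M0 : 0 < smooth_model_curvature.
  by rewrite addr_gt0 // divr_gt0 // exprn_gt0.
have [xg rate] := apg_rate g_proper g_lsc g_convex M0
  smooth_model_ge_linear smooth_model_le_quadratic yg Sg k0.
split=> //; rewrite /inexact_step -/S in rate *.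
set x := (apg _ _ _ _ _).1 in rate *.
have := le_moreau_env h_lip nu0 (linearization x).
have := moreau_env_le h_convex h_lip nu0 (linearization S).
move: rate; rewrite /smooth_model /model_value.
move: (moreau_env _ _ _) (moreau_env _ _ _) (fine _) (fine _) (h _) (h _).
move: (2 * smooth_model_curvature / _) (enorm _ ^+ 2) (enorm _ ^+ 2).
clearbody mu => *; lra.
Qed.

End ProxLinearStep.

(** * Progress of one outer iteration *)

Section OuterProgress.
Variables (R : realType) (d m : nat).
Variables (g : 'rV[R]_d -> \bar R) (h : 'rV[R]_m -> R) (c : 'rV[R]_d -> 'rV[R]_m).
Variables (L beta normJ eps : R).
Hypotheses (problem : composite_problem g h c L beta).
Hypotheses (L0 : 0 < L) (beta0 : 0 < beta) (normJ0 : 0 < normJ) (eps0 : 0 < eps).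

Let mu := L * beta.
Let mu0 : 0 < mu. Proof. exact: mulr_gt0. Qed.

(** With this parameter the smoothing error nu L^2 / 2 equals eps^2 / (64 mu). *)
Definition smoothing : R := eps ^+ 2 / (32 * (L * beta) * L ^+ 2).

Definition curvature : R := smooth_model_curvature L beta normJ smoothing.

Definition objective_value z : R := fine (g z) + h (c z).

Variable k : nat.
Hypotheses (k0 : (0 < k)%N) (kM : 32 * curvature <= mu * (k * k.+1)%:R).

Lemma smoothing_gt0 : 0 < smoothing.
Proof. by rewrite divr_gt0 ?exprn_gt0 // !mulr_gt0 // exprn_gt0. Qed.

Variable y : 'rV[R]_d.
Hypotheses (yg : edom g y) (Jy : opnorm (jacobian c y) <= normJ).

Let S := prox_linear_step g h c mu^-1 y.
Let xp := inexact_step g h c L beta y normJ smoothing k.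
Let e := eps / mu.
Let e0 : 0 < e. Proof. exact: divr_gt0. Qed.

Lemma inexact_step_edom : edom g xp.
Proof.
by have [] := inexact_step_spec problem L0 beta0 yg normJ0 Jy smoothing_gt0 k0.
Qed.

Lemma inexact_step_model : model_value g h c L beta y xp <=
  model_value g h c L beta y S + mu / 16 * enorm (S - y) ^+ 2 + mu / 64 * e ^+ 2.
Proof.
have [_] := inexact_step_spec problem L0 beta0 yg normJ0 Jy smoothing_gt0 k0.
rewrite -/mu -/S -/xp => spec; apply: le_trans spec _.
have -> : smoothing * L ^+ 2 / 2 = mu / 64 * e ^+ 2.
  by rewrite /smoothing -/mu /e; clearbody mu; field; rewrite !gt_eqF.
rewrite lerD2r lerD2l ler_wpM2r ?sqr_ge0 //.
have K0 : 0 < (k * k.+1)%:R :> R by rewrite ltr0n muln_gt0 k0.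
rewrite ler_pdivrMr //; move: kM; rewrite /curvature.
by move: (smooth_model_curvature _ _ _ _) ((k * k.+1)%:R); clearbody mu; move=> *; lra.
Qed.

(** Strong convexity of the model at S converts the model error into a distance. *)
Lemma inexact_step_error :
  enorm (xp - S) ^+ 2 <= enorm (S - y) ^+ 2 / 8 + e ^+ 2 / 32.
Proof.
rewrite -(ler_pM2l mu0).
have [_ /(_ _ inexact_step_edom)] := prox_linear_step_spec problem L0 beta0 yg.
rewrite -/mu -/S; have := inexact_step_model.
move: (model_value _ _ _ _ _ _ _) (model_value _ _ _ _ _ _ _).
move: (enorm (xp - S) ^+ 2) (enorm (S - y) ^+ 2) (e ^+ 2).
by clearbody mu => *; lra.
Qed.

(** If |S - y| exceeded e = eps / mu, the error bound would give
    |xp - S| < |S - y| / 2, hence |xp - y| > |S - y| / 2 > e / 2. *)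
Lemma stop_test_sound : enorm (xp - y) <= e / 2 -> enorm (S - y) <= e.
Proof.
move=> small; rewrite leNgt; apply/negP => eD.
have tri : enorm (S - y) <= enorm (xp - S) + enorm (xp - y).
  have := enormD (- (xp - S)) (xp - y).
  by rewrite enormN opprB addrA subrK.
have := inexact_step_error.
have := enorm_ge0 (xp - S); have := enorm_ge0 (S - y).
move: tri small eD e0; move: (enorm (xp - S)) (enorm (S - y)) (enorm (xp - y)) e.
move=> E D T a tri small aD a0 D0 E0 err.
have ED : E ^+ 2 < (D / 2) ^+ 2 by nra.
have : E < D / 2; last by lra.
by rewrite ltNge; apply/negP => DE; nra.
Qed.

(** A long step |xp - y| > e / 2 forces |S - y|^2 > e^2 / 12 by the error bound, and
    the exact decrease mu/2 |S - y|^2 minus the model error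
    mu/16 |S - y|^2 + mu/64 e^2 is then at least mu e^2 / 48. *)
Lemma no_stop_descent : e / 2 < enorm (xp - y) ->
  objective_value xp <= objective_value y - eps ^+ 2 / (48 * mu).
Proof.
move=> large.
have far : (e / 2) ^+ 2 < 2 * enorm (S - y) ^+ 2 + 2 * enorm (xp - S) ^+ 2.
  have : (e / 2) ^+ 2 < enorm (xp - y) ^+ 2.
    by rewrite ltr_pXn2r ?nnegrE ?enorm_ge0 // divr_ge0 // ltW.
  move/lt_le_trans; apply.
  have -> : xp - y = (S - y) + (xp - S) by rewrite [RHS]addrC addrA subrK.
  have := dot_ge0 ((S - y) - (xp - S)).
  move: (S - y) (xp - S) => a b.
  by rewrite !enorm_sqr !dotE (dotC b a); lra.
have maj := model_majorizes problem L0 beta0 y xp.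
have [_ /(_ _ yg)] := prox_linear_step_spec problem L0 beta0 yg.
have := inexact_step_model; have := inexact_step_error.
rewrite /model_value /objective_value -/mu -/S.
have -> : linearization c y y = c y by rewrite /linearization subrr mul0mx addr0.
rewrite subrr (_ : enorm 0 = 0) ?expr0n /= ?mulr0; last by rewrite /enorm dot0l sqrtr0.
have -> : enorm (y - S) = enorm (S - y) by rewrite -enormN opprB.
have -> : eps ^+ 2 / (48 * mu) = mu * (e ^+ 2 / 48).
  by rewrite /e; clearbody mu; field; rewrite gt_eqF.
rewrite -/mu in maj.
move: far maj.
rewrite (_ : (e / 2) ^+ 2 = e ^+ 2 / 4); last by rewrite expr_div_n; congr (_ / _); ring.
move: (fine _) (fine _) (fine _) (h _) (h _) (h _) (h _).
move: (enorm (S - y) ^+ 2) (enorm (xp - S) ^+ 2) (enorm (xp - y) ^+ 2) (e ^+ 2).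
move: mu0; clearbody mu => _ D E T a F1 F2 F3 h1 h2 h3 h4.
move=> far maj err mdl sc.
have dist : 0 <= mu * (D - a / 12) by rewrite mulr_ge0 ?(ltW mu0) //; lra.
lra.
Qed.

End OuterProgress.

(** * The register program and its execution *)

Section Program.
Variable R : realType.

(** Programs carry proximal parameters as positive numbers, while a method must
    be defined for arbitrary real inputs; the value 1 is a default. *)
Definition to_posnum (x : R) : {posnum R} :=
  if pselect (0 < x) is left x0 then PosNum x0 else 1%:pos.

Lemma to_posnumK x : 0 < x -> (to_posnum x)%:num = x.
Proof. by rewrite /to_posnum => x0; case: pselect. Qed.

Variables mu M nu tol : R.

(** Register X0 holds the base point y and Y0 holds c y; X1 and X2 hold the two
    iterates of the accelerated method; X3, X4, X5, Y1 and Y2 are scratch. *)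
Definition inner_step (j : nat) (p : program R) : program R :=
  let th := apg_theta R j in
  let t := apg_weight R j / M in
  CombX 3 (1 - th) 1 th 2 (
  CombX 4 1 3 (-1) 0 (
  MulJac 1 0 4 (
  CombY 1 1 0 1 1 (
  ProxH (to_posnum nu) 2 1 (
  CombY 1 nu^-1 1 (- nu^-1) 2 (
  MulJacT 5 0 1 (
  CombX 4 1 5 mu 4 (
  CombX 2 1 2 (- t) 4 (
  ProxG (to_posnum t) 2 2 (
  CombX 1 (1 - th) 1 th 2 p)))))))))).

(** The recursion puts step 0 first, so that the loop follows the recursion of
    [apg] when the continuation p is generalized. *)
Fixpoint inner_loop (k : nat) (p : program R) : program R :=
  if k is j.+1 then inner_loop j (inner_step j p) else p.

(** [Return 0] returns the base point y, not the new point: the stopping test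
    certifies that y is almost stationary. *)
Definition outer_step (k : nat) (p : program R) : program R :=
  EvalC 0 0 (
  CombX 1 1 0 0 0 (
  CombX 2 1 0 0 0 (
  inner_loop k (
  CombX 3 1 1 (-1) 0 (
  DotX 3 3 (fun s =>
    if s <= tol ^+ 2 then Return 0 else CombX 0 1 1 0 1 p)))))).

Fixpoint prox_linear_program (k N : nat) : program R :=
  if N is n.+1 then outer_step k (prox_linear_program k n) else Return 0.

End Program.

Section Correctness.
Variables (R : realType) (d m : nat).
Variables (g : 'rV[R]_d -> \bar R) (h : 'rV[R]_m -> R) (c : 'rV[R]_d -> 'rV[R]_m).
Variables (L beta normJ eps : R).
Hypotheses (problem : composite_problem g h c L beta).
Hypotheses (L0 : 0 < L) (beta0 : 0 < beta) (normJ0 : 0 < normJ) (eps0 : 0 < eps).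
Hypothesis Jbound : forall y, edom g y -> opnorm (jacobian c y) <= normJ.

Let mu := L * beta.
Let mu0 : 0 < mu. Proof. exact: mulr_gt0. Qed.
Let nu := smoothing L beta eps.
Let M := curvature L beta normJ eps.
Let nu0 : 0 < nu. Proof. exact: smoothing_gt0. Qed.
Let M0 : 0 < M.
Proof. by apply: addr_gt0 mu0; apply: divr_gt0 nu0; exact: exprn_gt0. Qed.

Definition inner_state y (s : 'rV[R]_d * 'rV[R]_d)
    (X : nat -> 'rV[R]_d) (Y : nat -> 'rV[R]_m) : Prop :=
  [/\ X 0%N = y, Y 0%N = c y, X 1%N = s.1 & X 2%N = s.2].

Lemma run_inner_step y s j p X Y : inner_state y s X Y ->
  exists X' Y',
    inner_state y (apg_step g (smooth_model_grad h c L beta y nu) M j s) X' Y' /\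
    run g h c (inner_step mu M nu j p) X Y =
      ((run g h c p X' Y').1, ((run g h c p X' Y').2 + 4)%N).
Proof.
move=> [X0 Y0 X1 X2].
have t0 : 0 < apg_weight R j / M by rewrite !divr_gt0 ?ltr0n.
rewrite /inner_step /= (to_posnumK nu0) (to_posnumK t0).
do 2 eexists; split; last by rewrite addn4.
split; [exact: X0|exact: Y0| |];
  rewrite /apg_step /smooth_model_grad /linearization /moreau_grad -/mu /=;
  by rewrite X0 Y0 X1 X2 !scale1r scaleN1r !scaleNr.
Qed.

Lemma run_inner_loop y k p X Y : inner_state y (y, y) X Y ->
  exists X' Y',
    inner_state y (apg g (smooth_model_grad h c L beta y nu) M k y) X' Y' /\
    run g h c (inner_loop mu M nu k p) X Y =
      ((run g h c p X' Y').1, ((run g h c p X' Y').2 + 4 * k)%N).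
Proof.
move=> init; elim: k p => [|k IH] p /=.
  by exists X, Y; rewrite muln0 addn0; split => //; case: (run _ _ _ _ _ _).
have [X1 [Y1 [st1 ->]]] := IH (inner_step mu M nu k p).
have [X2 [Y2 [st2 ->]]] := run_inner_step k p st1.
by exists X2, Y2; split => //=; rewrite -addnA mulnS.
Qed.

Variable k : nat.
Hypotheses (k0 : (0 < k)%N) (kM : 32 * M <= mu * (k * k.+1)%:R).

Lemma run_outer_step y p X Y : X 0%N = y ->
  exists X' Y',
    let x := inexact_step g h c L beta y normJ nu k in
    X' 0%N = x /\
    run g h c (outer_step mu M nu (eps / mu / 2) k p) X Y =
      if enorm (x - y) <= eps / mu / 2 then (y, (4 * k).+1)
      else ((run g h c p X' Y').1, ((run g h c p X' Y').2 + 4 * k).+1).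
Proof.
move=> X0; rewrite /outer_step /=.
set p' := CombX _ _ _ _ _ _.
pose X1 := [eta [eta X with 1%N |-> 1 *: X 0%N + 0 *: X 0%N]
  with 2%N |-> 1 *: X 0%N + 0 *: X 0%N].
pose Y1 := [eta Y with 0%N |-> c (X 0%N)].
have start : inner_state y (y, y) X1 Y1.
  by split; rewrite /X1 /Y1 /= X0 // scale1r scale0r addr0.
have [X2 [Y2 [[X20 Y20 X21 X22] runE]]] := run_inner_loop k p' start.
rewrite runE.
set x := inexact_step _ _ _ _ _ _ _ _ _.
have X21' : X2 1%N = x by [].
eexists _, _; split; last first.
  rewrite /p' /= scale1r scaleN1r X20 X21'.
  rewrite enorm_le; last by rewrite !divr_ge0 // ltW.
  by case: ifP => _ //=; rewrite X20.
by rewrite /= X21' scale1r scale0r addr0.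
Qed.

Variable lower : R.
Hypothesis lowerP : forall z, edom g z -> lower <= objective_value g h c z.

(** Each unsuccessful round lowers the objective by eps^2 / (48 mu), so N rounds
    suffice when the gap to the lower bound is less than N times that amount; with
    no round left, the gap would be negative. *)
Lemma run_prox_linear_program N X Y (y := X 0%N) : edom g y ->
  objective_value g h c y - lower < N%:R * (eps ^+ 2 / (48 * mu)) ->
  let result := run g h c (prox_linear_program mu M nu (eps / mu / 2) k N) X Y in
  enorm (prox_gradient g h c mu^-1 result.1) <= eps /\
  (result.2 <= N * (4 * k).+1)%N.
Proof.
rewrite {}/y; elim: N X Y => [|N IH] X Y yg gap.
  by have := lowerP yg; rewrite -subr_ge0 leNgt; move: gap; rewrite mul0r => ->.
rewrite -[prox_linear_program _ _ _ _ _ N.+1]/(outer_step mu M nu (eps / mu / 2) k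
  (prox_linear_program mu M nu (eps / mu / 2) k N)).
have [X' [Y' [X'0 ->]]] := run_outer_step
  (prox_linear_program mu M nu (eps / mu / 2) k N) Y (erefl (X 0%N)).
have Jy := Jbound yg.
case: ifPn => [small|]; last rewrite -ltNge => large /=.
  split=> /=; last by rewrite mulSn leq_addr.
  have := stop_test_sound problem L0 beta0 normJ0 eps0 k0 kM yg Jy small.
  rewrite /prox_gradient invrK -/mu enormZ gtr0_norm // -enormN opprB.
  by rewrite ler_pdivlMr // mulrC.
have xg := inexact_step_edom problem L0 beta0 normJ0 eps0 k0 yg Jy.
have desc := no_stop_descent problem L0 beta0 normJ0 eps0 k0 kM yg Jy large.
have [||good cost] := IH X' Y'; rewrite ?X'0 //.
  rewrite -/mu -/nu in desc *; apply: le_lt_trans (lerB desc (lexx _)) _.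
  by rewrite -natr1 mulrDl mul1r in gap; lra.
split; first exact: good.
by rewrite /= [(N.+1 * _)%N]mulSn addSn ltnS addnC leq_add2l.
Qed.

End Correctness.

(** * The numbers of iterations *)

Section IterationCounts.
Variables (R : realType) (L beta normJ eps q : R).

(** The factor 33 works because, for r = L |nabla c| / eps >= 1,
    32 M / mu = 1024 r^2 + 32 <= (33 r)^2. *)
Definition inner_iterations : nat := (Num.truncn (33 * (L * normJ / eps))).+1.

(** More than 48 mu q / eps^2 rounds of decrease eps^2 / (48 mu) would exceed q,
    hence the initial gap. *)
Definition outer_iterations : nat :=
  (Num.truncn (48 * (L * beta) * q / eps ^+ 2)).+1.

Definition smoothed_prox_linear_method : program R :=
  prox_linear_program (L * beta) (curvature L beta normJ eps)
    (smoothing L beta eps) (eps / (L * beta) / 2)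
    inner_iterations outer_iterations.

Hypotheses (L1 : 1 <= L) (beta1 : 1 <= beta) (normJ1 : 1 <= normJ)
  (eps0 : 0 < eps) (eps1 : 1 <= eps^-1).

Let L0 : 0 < L. Proof. exact: lt_le_trans L1. Qed.
Let beta0 : 0 < beta. Proof. exact: lt_le_trans beta1. Qed.
Let normJ0 : 0 < normJ. Proof. exact: lt_le_trans normJ1. Qed.
Let r := L * normJ / eps.
Let r1 : 1 <= r.
Proof. by rewrite /r mulr_ege1 // mulr_ege1. Qed.

Lemma inner_iterations_enough : 32 * curvature L beta normJ eps <=
  L * beta * (inner_iterations * inner_iterations.+1)%:R.
Proof.
have mu0 : 0 < L * beta by rewrite mulr_gt0.
have -> : 32 * curvature L beta normJ eps = L * beta * (1024 * r ^+ 2 + 32).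
  rewrite /curvature /smooth_model_curvature /smoothing /r.
  by field; rewrite !gt_eqF.
rewrite ler_pM2l //.
have kr : 33 * r < inner_iterations%:R := truncnS_gt _.
rewrite natrM -[inner_iterations.+1%:R]natr1.
move: (inner_iterations%:R) kr r1; clearbody r => K; nra.
Qed.

Lemma inner_iterations_le : inner_iterations%:R <= 34 * r.
Proof.
have /truncn_itv/andP[h _] : 0 <= 33 * r by have := r1; lra.
by rewrite /inner_iterations -natr1 -/r; have := r1; lra.
Qed.

End IterationCounts.

(** * The complexity bound *)

Section InitialGap.
Variables (R : realType) (d m : nat).
Variables (g : 'rV[R]_d -> \bar R) (h : 'rV[R]_m -> R) (c : 'rV[R]_d -> 'rV[R]_m).
Hypothesis g_proper : proper_fun g.
Hypothesis bounded_below : (-oo < ereal_inf (range (objective g h c)))%E.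

Lemma objectiveE z : edom g z -> objective g h c z = (objective_value g h c z)%:E.
Proof. by move=> zg; rewrite /objective EFinD fineK // fin_num_edom. Qed.

Lemma ereal_inf_objective_fin x0 : edom g x0 ->
  ereal_inf (range (objective g h c)) \is a fin_num.
Proof.
move=> x0g; rewrite fin_numE -ltNye bounded_below -ltey /=.
apply: (@le_lt_trans _ _ (objective g h c x0)); last by rewrite objectiveE // ltry.
by apply: ereal_inf_lbound; exists x0.
Qed.

Let lower : R := fine (ereal_inf (range (objective g h c))).

Lemma lower_le_objective z : edom g z -> lower <= objective_value g h c z.
Proof.
move=> zg; rewrite -lee_fin -objectiveE // fineK; last exact: ereal_inf_objective_fin zg.
by apply: ereal_inf_lbound; exists z.
Qed.

Lemma initial_gapE x0 : edom g x0 ->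
  initial_gap g h c x0 = objective_value g h c x0 - lower.
Proof.
move=> x0g; rewrite /initial_gap objectiveE //.
by rewrite -(fineK (ereal_inf_objective_fin x0g)) -EFinB.
Qed.

End InitialGap.

Theorem mainTheorem10 (R : realType) (gamma1 gamma2 : R)
    (hgamma1 : 1 <= gamma1) (hgamma2 : gamma1 <= gamma2) :
  exists (K C : R) (method : first_order_method R),
    0 < K /\ 0 < C /\
    forall (d m : nat) (g : 'rV[R]_d -> \bar R) (h : 'rV[R]_m -> R)
      (c : 'rV[R]_d -> 'rV[R]_m) (L beta normJ eps q : R) (x0 : 'rV[R]_d),
      composite_problem g h c L beta ->
      (ereal_sup [set (opnorm (jacobian c x))%:E | x in edom g] <= normJ%:E)%E ->
      edom g x0 ->
      0 < eps ->
      (-oo < ereal_inf (range (objective g h c)))%E ->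
      K <= normJ -> K <= L -> K <= beta ->
      K <= initial_gap g h c x0 -> K <= eps^-1 ->
      0 < q ->
      gamma1 <= q / initial_gap g h c x0 <= gamma2 ->
      let result := run_from g h c (method L beta normJ eps q) x0 in
      enorm (prox_gradient g h c (L * beta)^-1 result.1) <= eps /\
      result.2%:R <=
        C * (L ^+ 2 * beta * normJ * initial_gap g h c x0 / eps ^+ 3).
Proof.
have gamma2_ge1 : 1 <= gamma2 := le_trans hgamma1 hgamma2.
exists 1, (49 * (137 * gamma2)), (@smoothed_prox_linear_method R).
split; first exact: ltr01.
split; first by rewrite !mulr_gt0 // (lt_le_trans ltr01).
move=> d m g h c L beta normJ eps q x0 problem Jsup x0g eps0 bounded.
move=> normJ1 L1 beta1 gap1 eps1 q0 /andP[qlo qhi].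
have L0 : 0 < L := lt_le_trans ltr01 L1.
have beta0 : 0 < beta := lt_le_trans ltr01 beta1.
have normJ0 : 0 < normJ := lt_le_trans ltr01 normJ1.
have mu0 : 0 < L * beta by rewrite mulr_gt0.
have Jbound y : edom g y -> opnorm (jacobian c y) <= normJ.
  move=> yg; rewrite -lee_fin; apply: le_trans Jsup.
  by apply: ereal_sup_ubound; exists y.
have g_proper := reg_proper problem.
set gap := initial_gap g h c x0 in gap1 qlo qhi *.
have gap0 : 0 < gap := lt_le_trans ltr01 gap1.
rewrite ler_pdivlMr // in qlo; rewrite ler_pdivrMr // in qhi.
have gapq : gap <= q by apply: le_trans qlo; rewrite ler_peMl // ltW.
set N := outer_iterations L beta eps q.
set k := inner_iterations L normJ eps.
pose w := L * beta * gap / eps ^+ 2.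
(* The gap is at most q because gamma1 >= 1; it is exceeded by the total decrease. *)
have fuel : objective_value g h c x0 - fine (ereal_inf (range (objective g h c))) <
    N%:R * (eps ^+ 2 / (48 * (L * beta))).
  rewrite -(initial_gapE g_proper bounded x0g); apply: le_lt_trans gapq _.
  have : 48 * (L * beta) * q / eps ^+ 2 < N%:R := truncnS_gt _.
  rewrite ltr_pdivrMr ?exprn_gt0 // [N%:R * (_ / _)]mulrA ltr_pdivlMr ?mulr_gt0 //.
  by rewrite [q * _]mulrC.
have [good cost] := run_prox_linear_program problem L0 beta0 normJ0 eps0 Jbound
  (ltn0Sn _) (inner_iterations_enough L1 beta1 normJ1 eps0 eps1)
  (lower_le_objective g_proper bounded)
  (X := fun i => if i == 0%N then x0 else 0) (fun=> 0) x0g fuel.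
split; first exact: good.
have {cost}cost : (run_from g h c (smoothed_prox_linear_method L beta normJ eps q) x0).2%:R
    <= N%:R * (4 * k%:R + 1) :> R.
  rewrite -[4]/(4%:R) -natrM natr1 -natrM ler_nat; exact: cost.
apply: le_trans cost _.
have -> : 49 * (137 * gamma2) * (L ^+ 2 * beta * normJ * gap / eps ^+ 3) =
    49 * (gamma2 * w) * (137 * (L * normJ / eps)).
  by rewrite /w; field; rewrite gt_eqF.
have kr := inner_iterations_le L1 normJ1 eps1; rewrite -/k in kr.
have r1 : 1 <= L * normJ / eps by rewrite mulr_ege1 // mulr_ege1.
(* Both factors of the bound are at least 1, which absorbs the rounding of N and k. *)
have w1 : 1 <= gamma2 * w.
  rewrite mulr_ege1 // /w -exprVn mulr_ege1 //; last by rewrite exprn_ege1.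
  by rewrite mulr_ege1 // mulr_ege1.
apply: ler_pM; [by []| by rewrite addr_ge0 // mulr_ge0 | |by lra].
have qw : 48 * (L * beta) * q / eps ^+ 2 <= 48 * (gamma2 * w).
  have -> : 48 * (gamma2 * w) = 48 * (L * beta) * (gamma2 * gap) / eps ^+ 2.
    by rewrite /w; field; rewrite gt_eqF.
  rewrite ler_wpM2r ?invr_ge0 ?sqr_ge0 // ler_wpM2l // mulr_ge0 //; exact: ltW.
have /truncn_itv/andP[h1 _] : 0 <= 48 * (L * beta) * q / eps ^+ 2.
  by rewrite divr_ge0 ?sqr_ge0 // !mulr_ge0 // ltW.
by rewrite /N /outer_iterations -natr1; lra.
Qed.
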